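(* Let $X$ be any absolutely continuous real random variable with hazard function $h_X$, let $X_1, X_2,\ldots$ be i.i.d. copies of $X$, and let $M_n = \max(X_1,\ldots,X_n)$. For any sequence of norming constants $a_n > 0$, $b_n\in\mathbb{R}$, writing $N_n = (M_n - b_n)/a_n$, we have $$\mathbb{E}\,\Theta_{N_n}(N_n) = \left(\log a_n + \mathbb{E}\log h_X(M_n)\right) + \left(\log n - H_n\right) + \frac{1}{n},$$ where $H_n := 1 + \frac12 + \frac13 + \cdots + \frac1n$ is the $n$th harmonic number.
   Context: For an absolutely continuous real random variable $Z$ with distribution function $F_Z(z)=\mathbb{P}(Z\le z)$ and density $f_Z = F_Z'$, the hazard function is $h_Z(z) = f_Z(z)/(1-F_Z(z))$ and the max-score function is $\Theta_Z(z) := \log\left(f_Z(z)/F_Z(z)\right)$. Logarithms are natural. *)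

(* Defs.v *)
From HB Require Import structures.
From mathcomp Require Import all_boot all_order all_algebra.
From mathcomp Require Import finmap.
From mathcomp Require Import all_classical all_reals all_analysis.
From mathcomp Require Import measurable_realfun.

Set Implicit Arguments.
Unset Strict Implicit.
Unset Printing Implicit Defensive.

Import Order.TTheory GRing.Theory Num.Theory.
Import numFieldNormedType.Exports.

Local Open Scope classical_set_scope.
Local Open Scope ring_scope.

Section hazard_and_max_score.
Context (d : measure_display) (T : measurableType d) (R : realType).
Variables (P : probability T R) (Z : {RV P >-> R}).

Definition abs_continuous : Prop := distribution P Z `<< lebesgue_measure.

Definition dist_fun (z : R) : R := fine (cdf Z z).

(* The value of [derive1] is a convention at points where [dist_fun] is not
   differentiable.  For an absolutely continuous [Z] these points form a
   Lebesgue-null set, hence have probability zero under the law of [Z]. *)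
Definition density : R -> R := derive1 dist_fun.

Definition hazard (z : R) : R := density z / (1 - dist_fun z).

(* [ln x = 0] for [x <= 0] and [x / 0 = 0] here.  For an absolutely continuous
   [Z], almost surely [density Z > 0] and [0 < dist_fun Z < 1], so these
   conventions do not affect expectations. *)
Definition max_score (z : R) : R := ln (density z / dist_fun z).

End hazard_and_max_score.

Section iid.
Context (d : measure_display) (T : measurableType d) (R : realType).
Variable P : probability T R.

(* Equality of laws is required on measurable sets only: a measure is not
   constrained outside its sigma-algebra. *)
Definition same_law (d' : measure_display) (T' : measurableType d')
    (P' : probability T' R) (Y : {RV P >-> R}) (Y' : {RV P' >-> R}) : Prop :=
  forall A : set R, measurable A -> distribution P Y A = distribution P' Y' A.

Definition mutually_independent (I : choiceType) (Y : I -> {RV P >-> R}) : Prop :=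
  forall (J : {fset I}) (A : I -> set R), (forall i, measurable (A i)) ->
    P (\bigcap_(i in [set` J]) (Y i @^-1` A i)) =
    (\prod_(i <- J) P (Y i @^-1` A i))%E.

(* The law is compared with a variable on a possibly different probability
   space, which need not be rich enough to carry the sequence [Y]. *)
Definition iid_copies (d' : measure_display) (T' : measurableType d')
    (P' : probability T' R) (Z : {RV P' >-> R}) (Y : nat -> {RV P >-> R}) : Prop :=
  mutually_independent Y /\ forall i, same_law (Y i) Z.

End iid.

Section max_and_norming.
Context (d : measure_display) (T : measurableType d) (R : realType).
Variable P : probability T R.

(* [Y i] is the (i+1)-st variable, so this is the maximum of the first [n]
   variables for [0 < n]; the default [Y 0] is then one of them. *)
Definition sample_max (Y : nat -> {RV P >-> R}) (n : nat) (t : T) : R :=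
  \big[Num.max/Y 0%N t]_(i < n) Y i t.

Lemma measurable_sample_max (Y : nat -> {RV P >-> R}) (n : nat) :
  measurable_fun [set: T] (sample_max Y n).
Proof.
rewrite /sample_max; elim: (index_enum _) => [|i s ihs].
  by apply: (eq_measurable_fun (Y 0%N)) => // t _; rewrite big_nil.
apply: eq_measurable_fun (measurable_maxr (f := Y i) _ ihs) => //.
by move=> t _; rewrite big_cons.
Qed.

HB.instance Definition _ (Y : nat -> {RV P >-> R}) (n : nat) :=
  isMeasurableFun.Build _ _ _ _ (sample_max Y n) (measurable_sample_max Y n).

Definition normed (a b : R) (Z : {RV P >-> R}) (t : T) : R := (Z t - b) / a.

Lemma measurable_normed (a b : R) (Z : {RV P >-> R}) :
  measurable_fun [set: T] (normed a b Z).
Proof.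
by apply: measurable_funM => //; apply: measurable_funB.
Qed.

HB.instance Definition _ (a b : R) (Z : {RV P >-> R}) :=
  isMeasurableFun.Build _ _ _ _ (normed a b Z) (measurable_normed a b Z).

End max_and_norming.

Definition harmonic_number (R : realType) (n : nat) : R :=
  \sum_(1 <= k < n.+1) k%:R^-1.

(* Main.v *)
Require Import Defs.
From HB Require Import structures.
From mathcomp Require Import all_boot all_order all_algebra.
From mathcomp Require Import finmap.
From mathcomp Require Import all_classical all_reals all_analysis.
From mathcomp Require Import measurable_realfun ring lra.

(** Write [F] and [f] for the distribution function and the density of [X] and
    [M] for the maximum of [n] copies.  Independence gives [F ^+ n] as the
    distribution function of [M], hence [z |-> F (a z + b) ^+ n] for the normed
    maximum [N].  Differentiating at [N], where [a N + b = M],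

      [Theta_N(N) = ln (n a f(M) / F(M))
                  = ln h(M) + ln n + ln a - ln F(M) + ln (1 - F(M))],

    where [h = f / (1 - F)] ([max_score_normedE]).  It remains to take
    expectations.  The variable [U = F(M)] satisfies [P (U <= u) = u ^+ n]
    ([dist_fun_max_sandwich], [power_law_le]), whatever the law of [X], so the last two
    terms have universal means: the layer-cake formula gives
    [E (- ln U) = 1 / n] and [E (- ln (1 - U)) = H_n]
    ([expectation_Nln_power_law], [expectation_Nln_onem_power_law]).

    Two points need care.  The identity above holds only where [F] is
    differentiable, [f > 0] and [0 < F < 1]; this has probability one because,
    by Radon-Nikodym and Lebesgue differentiation, [F' = g] almost everywhere
    for a measurable [g] ([dist_fun_density_ae]), and integrals do not see the
    exceptional null event even though the functions involved are not known to
    be measurable on it ([ae_eq_integralT]).  And [E ln h(M)] may be infinite,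
    or undefined with conventional value [-oo]; as [ln (1 - U) - ln U] is
    integrable the expectation still splits, in the extended reals
    ([integralD_integrabler]). *)

Set Implicit Arguments.
Unset Strict Implicit.
Unset Printing Implicit Defensive.

Import Order.TTheory GRing.Theory Num.Theory.
Import numFieldNormedType.Exports.
Local Open Scope classical_set_scope.
Local Open Scope ring_scope.

(** * Integrals up to null sets and additivity *)

Lemma posneg_part_bounds (R : realType) (r : R) :
  [/\ r <= Num.max r 0, - r <= Num.max (- r) 0, 0 <= Num.max r 0,
      0 <= Num.max (- r) 0 & Num.max r 0 = Num.max (- r) 0 + r].
Proof.
rewrite !le_max !lexx !orbT; split => //.
by rewrite /Num.max oppr_lt0; case: (ltrgtP r 0) => *; lra.
Qed.

Section null_set.
Context d (T : measurableType d) (R : realType).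
Variable mu : {measure set T -> \bar R}.
Local Open Scope ereal_scope.
Import HBNNSimple.

(** The integral of a nonnegative function is a supremum over the simple
    functions below it, and multiplying a simple function by the indicator of
    [~` A] does not change its integral; so measurability of [f] never
    enters. *)
Lemma ge0_integral_setC_null (f : T -> \bar R) (A : set T) :
  measurable A -> mu A = 0 -> (forall x, 0 <= f x) ->
  \int[mu]_x f x = \int[mu]_(x in ~` A) f x.
Proof.
move=> mA muA f0; apply/eqP; rewrite eq_le; apply/andP; split; last first.
  rewrite integral_mkcond !ge0_integralTE//; last by move=> x; rewrite patchE; case: ifP.
  apply: le_ereal_sup => /= _ [h hf <-]; exists h => // x.
  by apply: (le_trans (hf x)); rewrite patchE; case: ifP.
rewrite (integral_mkcond (~` A)) !ge0_integralTE//; last by move=> x; rewrite patchE; case: ifP.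
apply: ge_ereal_sup => /= _ [h hf <-].
have mCA := measurableC mA.
apply: ereal_sup_ubound; exists (proj_nnsfun h mCA).
  move=> x; rewrite -mrestrict !patchE; case: ifPn => _ //.
rewrite /= -mrestrict -integral_nnsfun//.
transitivity (\int[mu]_x (h x)%:E); last by rewrite integral_nnsfun// patch_setT.
symmetry; rewrite (@ge0_negligible_integral _ _ _ _ setT A)//.
- by rewrite setTD.
- by apply/measurable_EFinP.
- by move=> x _; rewrite lee_fin.
Qed.

Lemma integral_setC_null (f : T -> \bar R) (A : set T) :
  measurable A -> mu A = 0 ->
  \int[mu]_x f x = \int[mu]_(x in ~` A) f x.
Proof.
move=> mA muA; rewrite integralE [RHS]integralE.
by rewrite (ge0_integral_setC_null mA)// (ge0_integral_setC_null (f := f ^\-) mA).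
Qed.

(** Two functions that agree off a measurable null set have the same integral
    even if neither is measurable.  This matters for functions built from
    [density]: a derivative takes conventional values where it does not exist,
    and only its restriction to a set of full measure is known to be
    measurable. *)
Lemma ae_eq_integralT (f g : T -> \bar R) (A : set T) :
  measurable A -> mu A = 0 -> (forall x, ~ A x -> f x = g x) ->
  \int[mu]_x f x = \int[mu]_x g x.
Proof.
move=> mA muA fg; rewrite (integral_setC_null f mA muA) (integral_setC_null g mA muA).
by apply: eq_integral => x; rewrite inE => /fg.
Qed.

(** Additivity with only one integrable summand.  If the positive and negative
    parts of [f] both have infinite integral, so do those of [f + g], because
    the parts of [g] have finite integral; both sides are then the same value
    [+oo - oo]. *)
Lemma integralD_integrabler (f g : T -> R) :
  measurable_fun setT f -> mu.-integrable setT (EFin \o g) ->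
  \int[mu]_x (f x + g x)%:E = \int[mu]_x (f x)%:E + \int[mu]_x (g x)%:E.
Proof.
move=> mf ig.
have mg : measurable_fun setT g by apply/measurable_EFinP; exact: measurable_int ig.
have mfe : measurable_fun setT (EFin \o f) by apply/measurable_EFinP.
have mge : measurable_fun setT (EFin \o g) by apply/measurable_EFinP.
have mse : measurable_fun setT (EFin \o (f \+ g)%R).
  by apply/measurable_EFinP; exact: measurable_funD.
rewrite integralE [X in _ = X + _]integralE [X in _ = _ + X]integralE.
(* A, A' : the parts of f + g;  B, B' : those of f;  G, G' : those of g. *)
set A := \int[mu]_x _; set A' := \int[mu]_x _.
set B := \int[mu]_x _; set B' := \int[mu]_x _.
set G := \int[mu]_x _; set G' := \int[mu]_x _.
have [Gf G'f] : G \is a fin_num /\ G' \is a fin_num.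
  by split; [exact: integrable_pos_fin_num|exact: integrable_neg_fin_num].
have A0 : 0 <= A by exact: integral_ge0.
have A'0 : 0 <= A' by exact: integral_ge0.
have B0 : 0 <= B by exact: integral_ge0.
have B'0 : 0 <= B' by exact: integral_ge0.
have G0 : 0 <= G by exact: integral_ge0.
have G'0 : 0 <= G' by exact: integral_ge0.
(* Rearrangement of p(f+g) - n(f+g) = p(f) - n(f) + p(g) - n(g), where p and n
   are the positive and negative parts, so that only sums of nonnegative
   functions occur. *)
have key : A + (B' + G') = A' + (B + G).
  rewrite /A /B /G /A' /B' /G'.
  rewrite -!ge0_integralD//; try by [exact: measurable_funepos|exact: measurable_funeneg|
   apply: emeasurable_funD; [exact: measurable_funepos|exact: measurable_funepos]|
   apply: emeasurable_funD; [exact: measurable_funeneg|exact: measurable_funeneg]|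
   move=> x _; exact: adde_ge0].
  apply: eq_integral => x _.
  rewrite !(funeposE, funenegE)/= -!EFin_max.
  rewrite -!EFinD; congr EFin.
  have [_ _ _ _ ->] := posneg_part_bounds (f x + g x)%R.
  have [_ _ _ _ ->] := posneg_part_bounds (f x).
  have [_ _ _ _ ->] := posneg_part_bounds (g x).
  ring.
have bnd (p q r : T -> \bar R) :
    measurable_fun setT p -> measurable_fun setT q -> measurable_fun setT r ->
    (forall x, 0 <= p x) -> (forall x, 0 <= q x) -> (forall x, 0 <= r x) ->
    (forall x, p x <= q x + r x) ->
    \int[mu]_x p x <= \int[mu]_x q x + \int[mu]_x r x.
  move=> mp mq mr p0 q0 r0 pqr; rewrite -ge0_integralD//.
  by apply: ge0_le_integral => //; exact: emeasurable_funD.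
have [le1 le2] : A <= B + G /\ B <= A + G'.
  by split; apply: bnd => //; try solve [exact: measurable_funepos|exact: measurable_funeneg];
    move=> x; rewrite !(funeposE, funenegE)/= -!EFin_max -EFinD lee_fin ge_max;
    have [] := posneg_part_bounds (f x); have [] := posneg_part_bounds (g x);
    have [] := posneg_part_bounds (f x + g x)%R; do 15! move=> ?;
    apply/andP; split; lra.
have [le3 le4] : A' <= B' + G' /\ B' <= A' + G.
  by split; apply: bnd => //; try solve [exact: measurable_funepos|exact: measurable_funeneg];
    move=> x; rewrite !(funeposE, funenegE)/= -!EFin_max -EFinD lee_fin ge_max;
    have [] := posneg_part_bounds (f x); have [] := posneg_part_bounds (g x);
    have [] := posneg_part_bounds (f x + g x)%R; do 15! move=> ?;
    apply/andP; split; lra.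
(* The four bounds make A infinite exactly when B is, and A' exactly when B' is;
   in the finite case the equation can be solved. *)
move: G G' A A' B B' {A0 A'0 bnd} Gf G'f B0 B'0 G0 G'0 key le1 le2 le3 le4.
move=> [G||]// [G'||]// [A||] [A'||] [B||] [B'||]//= _ _ _ _ _ _ key _ _ _ _.
by move: key; rewrite -?EFinD => -[key]; congr EFin; lra.
Qed.
End null_set.

(** * Law of an absolutely continuous variable *)

Section law_of_absolutely_continuous_variable.
Context d (T : measurableType d) (R : realType) (P : probability T R).
Variable X : {RV P >-> R}.
Hypothesis hX : abs_continuous X.
Let mu : {sigma_finite_measure set (measurableTypeR R) -> \bar R} := lebesgue_measure.
(* Lebesgue measure lives on [measurableTypeR R], whose sigma-algebra is the one
   of [R] under another display; [Y] is [X] with values in that copy of [R]. *)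
Let Y : T -> measurableTypeR R := X.
Let mY : measurable_fun setT Y. Proof. exact: (measurable_funPT X). Qed.
#[local] HB.instance Definition _ := isMeasurableFun.Build _ _ T (measurableTypeR R) Y mY.
Let nu : {finite_measure set (measurableTypeR R) -> \bar R} := distribution P Y.

Lemma radon_nikodym_density : exists g : R -> R,
  [/\ measurable_fun setT g, (forall x, 0 <= g x),
      mu.-integrable setT (EFin \o g) &
      forall A, measurable A ->
        distribution P X A = (\int[mu]_(x in A) (g x)%:E)%E].
Proof.
have [f [f0 ffin fint fI]] := @radon_nikodym_sigma_finite _ (measurableTypeR R) R mu nu hX.
have fE : EFin \o (fine \o f) = f by apply/funext => x /=; rewrite fineK.
exists (fine \o f); split.
- by apply/measurable_EFinP; rewrite fE; exact: measurable_int fint.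
- by move=> x; exact: fine_ge0.
- by rewrite fE.
- move=> A mA; rewrite [LHS](fI A)//.
  by apply: eq_integral => x _ /=; rewrite fineK.
Qed.

(** By Lebesgue differentiation the distribution function is differentiable
    almost everywhere, with derivative the Radon-Nikodym density [g].  A law has
    no mass where its density vanishes, whence positivity. *)
Lemma dist_fun_density_ae : exists (g : R -> R) (B : set R),
  [/\ measurable_fun setT g, measurable B, distribution P X B = 0%E &
   forall x, ~ B x -> [/\ derivable (dist_fun X) x 1, density X x = g x & 0 < g x]].
Proof.
have [g [mg g0 ig gE]] := radon_nikodym_density.
have : {ae mu, forall x, derivable (fun y : R => \int[mu]_(t in [set` `]-oo, y]]) g t)%R x 1 /\
    derive1 (fun y : R => \int[mu]_(t in [set` `]-oo, y]]) g t)%R x = g x}.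
  apply: FTC1Ny.
    by move=> y; exact: integrableS ig.
  by apply: open_integrable_locally => //; exact: openT.
have FE : (fun y : R => \int[mu]_(t in [set` `]-oo, y]]) g t)%R = dist_fun X.
  by apply/funext => y; rewrite /dist_fun /cdf gE.
rewrite FE => -[N [mN muN subN]].
exists g, (N `|` (g @^-1` `]-oo, 0])); split => //.
- apply: measurableU => //; rewrite -[X in measurable X]setTI; exact: mg.
- apply/eqP; rewrite eq_le measure_ge0 andbT.
  have mg0 : measurable (g @^-1` `]-oo, 0]) by rewrite -[X in measurable X]setTI; exact: mg.
  rewrite (le_trans (measureU2 _ _ _))//.
  have nuN : distribution P X N = 0%E.
    by apply: (null_content_dominatesP _ _).1 muN.
  rewrite [X in (X + _)%E](nuN) add0e [leLHS](gE _ mg0).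
  rewrite integral0_eq// => x /=; rewrite in_itv/= => gx.
  by congr EFin; apply/le_anti; rewrite gx g0.
- move=> x /not_orP[Nx gx].
  have [dx e] : derivable (dist_fun X) x 1 /\ derive1 (dist_fun X) x = g x.
    by apply: contrapT => h; apply: Nx; exact: subN.
  split => //; rewrite ltNge; apply/negP => h; apply: gx.
  by rewrite /= in_itv.
Qed.

(** An indefinite integral is continuous, so the intermediate value theorem
    applies between a point where the distribution function is below [u] and
    one where it is above. *)
Lemma dist_fun_intermediate u : 0 < u < 1 -> exists x, dist_fun X x = u.
Proof.
move=> /andP[u0 u1].
have Ffin x : cdf X x = (dist_fun X x)%:E by rewrite fineK ?fin_num_measure.
have [a Fa] : exists a, dist_fun X a < u.
  have [M [_ hM]] := cvgr_lt _ (fine_cvg (cvg_cdfNy0 X)) _ u0.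
  by exists (M - 1); apply: hM; rewrite gtrBl.
have [b Fb] : exists b, u < dist_fun X b.
  have [M [_ hM]] := cvgr_gt _ (fine_cvg (cvg_cdfy1 X)) _ u1.
  by exists (M + 1); apply: hM; rewrite ltrDl.
have ab : a <= b.
  rewrite leNgt; apply/negP => /ltW ba.
  have := cdf_nondecreasing X ba; rewrite !Ffin lee_fin => h.
  by have := le_lt_trans h (lt_trans Fa Fb); rewrite ltxx.
have [g [mg g0 ig gE]] := radon_nikodym_density.
have FE y : dist_fun X y = (\int[mu]_(t in [set` `]-oo, y]]) g t)%R.
  by rewrite /dist_fun /cdf gE.
have Fint x : a <= x -> dist_fun X x - dist_fun X a = parameterized_integral mu a x g.
  move=> ax; rewrite !FE Rintegral_itvB// /parameterized_integral.
    by apply: Rintegral_itv_obnd_cbnd; apply: integrableS ig.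
  by apply: integrableS ig.
have iab : mu.-integrable [set` `[a, b]] (EFin \o g).
  by apply: integrableS ig.
have cg := parameterized_integral_continuous ab iab.
have [|c] := @IVT R _ a b (u - dist_fun X a) ab cg.
  rewrite -!Fint// subrr ge_min le_max.
  apply/andP; split; apply/orP; [left|right]; lra.
by rewrite in_itv/= => /andP[ac _]; rewrite -Fint// => /addIr <-; exists c.
Qed.

End law_of_absolutely_continuous_variable.

(** * Maximum of independent copies *)

Section maximum_of_iid_copies.
Context d0 (T0 : measurableType d0) d (T : measurableType d) (R : realType).
Context (P0 : probability T0 R) (P : probability T R).
Variables (X : {RV P0 >-> R}) (Xs : nat -> {RV P >-> R}) (n : nat).
Hypothesis hXs : iid_copies X Xs.

(** The maximum is at most [x] exactly when all [n] variables are, and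
    independence turns the probability of this intersection into a product. *)
Lemma dist_fun_sample_max (n0 : (0 < n)%N) x :
  dist_fun (sample_max Xs n : {RV P >-> R}) x = dist_fun X x ^+ n.
Proof.
have [ind law] := hXs.
rewrite /dist_fun /cdf /distribution /pushforward.
pose J : {fset nat} := seq_fset tt (iota 0 n).
have -> : sample_max Xs n @^-1` `]-oo, x] =
    \bigcap_(i in [set` J]) (Xs i @^-1` `]-oo, x]).
  apply/seteqP; split => t /=.
    rewrite in_itv/= => /bigmax_leP[_ h] i /=.
    rewrite seq_fsetE mem_iota/= add0n => iltn.
    by rewrite in_itv/=; exact: (h (Ordinal iltn)).
  move=> h; rewrite in_itv/=; apply/bigmax_leP; split.
    by have := h 0%N; rewrite /= seq_fsetE mem_iota/= add0n in_itv/=; apply.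
  by move=> i _; have := h i; rewrite /= seq_fsetE mem_iota/= add0n in_itv/=; apply.
rewrite (ind J (fun=> `]-oo, x]%classic))//.
rewrite (eq_bigr (fun=> (fine (P0 (X @^-1` `]-oo, x])))%:E)); last first.
  move=> i _; rewrite fineK; last by apply: fin_num_measure; exact: measurable_funPTI.
  exact: law.
rewrite prodEFin/= big_const_seq count_predT.
by rewrite -[size _]/(size J) (size_seq_fset tt) undup_id ?iota_uniq// size_iota iter_mulr_1.
Qed.

Lemma sample_max_eq t : exists i, sample_max Xs n t = Xs i t.
Proof.
rewrite /sample_max; elim/big_ind: _ => [|x y [i ->] [j ->]|i _]; first by exists 0%N.
  by rewrite /Num.max; case: ifP => _; [exists j|exists i].
by exists i.
Qed.

(** At each outcome the maximum is one of the variables, so its law is null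
    wherever their common law is. *)
Lemma sample_max_null (B : set R) : measurable B ->
  distribution P0 X B = 0%E -> P (sample_max Xs n @^-1` B) = 0%E.
Proof.
move=> mB B0.
have mM : measurable (sample_max Xs n @^-1` B).
  exact: (measurable_funPTI (sample_max Xs n : {RV P >-> R})).
apply/(negligibleP _ mM).
apply: (@negligibleS _ _ _ _ (\bigcup_i (Xs i @^-1` B))).
  by move=> t; have [i e] := sample_max_eq t; rewrite /preimage/= e => h; exists i.
apply: negligible_bigcup => i; apply/negligibleP; first exact: measurable_funPTI.
by rewrite -B0; exact: (hXs.2 i B mB).
Qed.

End maximum_of_iid_copies.

(** * Logarithmic means of a power law on the unit interval *)

Section power_law.
Context d (T : measurableType d) (R : realType) (P : probability T R).
Variables (U : {RV P >-> R}) (n : nat).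
Hypothesis n0 : (0 < n)%N.
(* This two-sided bound, rather than the distribution function itself, is what
   one value of the intermediate value theorem yields. *)
Hypothesis U_lt_le : forall u : R, 0 < u < 1 ->
  (P (U @^-1` `]-oo, u[) <= (u ^+ n)%:E <= P (U @^-1` `]-oo, u]))%E.

(** Monotonicity gives [v ^+ n <= P (U <= v) <= P (U < u)] for [v < u], and
    [v] may tend to [u]; [P (U < u) <= u ^+ n] is the other half. *)
Lemma power_law_lt (u : R) : 0 < u <= 1 -> P (U @^-1` `]-oo, u[) = (u ^+ n)%:E.
Proof.
move=> /andP[u0 u1].
have mU : measurable (U @^-1` `]-oo, u[) by exact: measurable_funPTI.
rewrite -[LHS]fineK ?fin_num_measure//; congr EFin; apply/le_anti/andP; split.
  have [->|u_neq1] := eqVneq u 1.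
    by rewrite expr1n -lee_fin fineK ?fin_num_measure ?probability_le1//; exact: measurable_funPTI.
  rewrite -lee_fin fineK ?fin_num_measure//.
  have u01 : 0 < u < 1 by rewrite u0 lt_neqAle u_neq1.
  by have /andP[] := U_lt_le u01.
rewrite leNgt; apply/negP => c.
have : (fun w => w ^+ n) @ u^'- --> u ^+ n.
  by apply: cvg_at_left_filter; exact: exprn_continuous.
move=> /cvgr_gt/(_ _ c) h.
have [v [cv v0 vu]] : exists v, [/\ fine (P (U @^-1` `]-oo, u[)) < v ^+ n, 0 < v & v < u].
  near u^'- => v; exists v; split; near: v => //.
  exact: nbhs_left_gt.
  exact: nbhs_left_lt.
have /andP[_] := U_lt_le (introT andP (conj v0 (lt_le_trans vu u1))).
apply/negP; rewrite -ltNge.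
have cv' : (P (U @^-1` `]-oo, u[) < (v ^+ n)%:E)%E.
  by rewrite -[ltLHS]fineK ?fin_num_measure// lte_fin.
apply: le_lt_trans cv'; apply: le_measure; rewrite ?inE//.
  exact: measurable_funPTI.
by move=> t /=; rewrite !in_itv/= => /le_lt_trans; apply.
Unshelve. all: by end_near. Qed.

Lemma power_law_le (u : R) : 0 <= u < 1 -> P (U @^-1` `]-oo, u]) = (u ^+ n)%:E.
Proof.
move=> /andP[u0 u1].
have mU : measurable (U @^-1` `]-oo, u]) by exact: measurable_funPTI.
rewrite -[LHS]fineK ?fin_num_measure//; congr EFin; apply/le_anti/andP; split; last first.
  have [->|u_neq0] := eqVneq u 0.
    by rewrite expr0n gtn_eqF//= fine_ge0.
  rewrite -lee_fin fineK ?fin_num_measure//.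
  have u01 : 0 < u < 1 by rewrite u1 lt_neqAle eq_sym u_neq0 u0.
  by have /andP[] := U_lt_le u01.
rewrite leNgt; apply/negP => c.
have : (fun w => w ^+ n) @ u^'+ --> u ^+ n.
  by apply: cvg_at_right_filter; exact: exprn_continuous.
move=> /cvgr_lt/(_ _ c) h.
have [v [cv v0 vu]] : exists v, [/\ v ^+ n < fine (P (U @^-1` `]-oo, u])), u < v & v < 1].
  near u^'+ => v; exists v; split; near: v => //.
  exact: nbhs_right_gt.
  exact: nbhs_right_lt.
have /andP[+ _] := U_lt_le (introT andP (conj (le_lt_trans u0 v0) vu)).
apply/negP; rewrite -ltNge.
have cv' : ((v ^+ n)%:E < P (U @^-1` `]-oo, u]))%E.
  by rewrite -[ltRHS]fineK ?fin_num_measure// lte_fin.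
apply: (lt_le_trans cv'); apply: le_measure; rewrite ?inE//.
  exact: measurable_funPTI.
by move=> t /=; rewrite !in_itv/= => /le_lt_trans; apply.
Unshelve. all: by end_near. Qed.

End power_law.

Lemma expRN_itv (R : realType) (r : R) : 0 <= r -> 0 < expR (- r) <= 1.
Proof. by move=> r0; rewrite expR_gt0 -expR0 ler_expR oppr_le0. Qed.

Section layer_cake.
Context d (T : measurableType d) (R : realType) (P : probability T R).
Let mu := @lebesgue_measure R.

(** The layer-cake formula for [- ln Q].  Since [ln] is [0] at nonpositive
    reals, [- ln Q > r] and [Q < expR (- r)] agree only where [Q > 0]. *)
Lemma expectation_Nln (Q : {RV P >-> R}) :
  (forall t, Q t <= 1) -> P (Q @^-1` `]-oo, 0]) = 0%E ->
  (\int[P]_t (- ln (Q t))%:E =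
   \int[mu]_(r in `[0%R, +oo[) P (Q @^-1` `]-oo, expR (- r)[))%E.
Proof.
move=> Q1 Q0.
pose V t := - ln (Q t).
have mV : measurable_fun setT V.
  by apply: measurableT_comp => //; apply: measurableT_comp.
pose VM := isMeasurableFun.Build _ _ _ _ V mV.
pose VR : {RV P >-> R} := HB.pack V VM.
have := @ge0_expectation_ccdf _ _ _ P VR.
rewrite unlock => -> /=; last by move=> t; rewrite oppr_ge0 ln_le0.
apply: eq_integral => r; rewrite inE/= in_itv/= andbT => r0.
have mexp : measurable (Q @^-1` `]-oo, expR (- r)[) by exact: measurable_funPTI.
have m0 : measurable (Q @^-1` `]-oo, 0]) by exact: measurable_funPTI.
rewrite /ccdf /distribution /pushforward.
have -> : V @^-1` `]r, +oo[ = (Q @^-1` `]-oo, expR (- r)[) `\` (Q @^-1` `]-oo, 0]).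
  apply/seteqP; split => t /=; rewrite /V !in_itv/= ?andbT.
    move=> rV; have Q_gt0 : 0 < Q t.
      rewrite ltNge; apply/negP => h.
      by move: rV; rewrite ln0// oppr0 ltNge r0.
    split; last by apply/negP; rewrite -ltNge.
    by rewrite -ltr_ln ?posrE ?expR_gt0// expRK ltrNr.
  move=> [Qe /negP]; rewrite -ltNge => Q_gt0.
  by rewrite ltrNr -[ltRHS]expRK ltr_ln// ?posrE ?expR_gt0.
rewrite measureD//; last by rewrite -ge0_fin_numE// fin_num_measure.
rewrite [X in (_ - X)%E](_ : _ = 0%E) ?sube0//.
apply/eqP; rewrite eq_le measure_ge0 andbT -Q0.
by apply: le_measure; rewrite ?inE//; exact: measurableI.
Qed.

(** The substitution [y = expR (- r)] turns this integral into that of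
    [q^`()] over [0, 1]; equivalently [- q.[expR (- r)]] is a primitive. *)
Lemma integral_horner_expRN (q : {poly R}) :
  (forall y, 0 <= y <= 1 -> 0 <= q^`().[y]) ->
  (\int[mu]_(r in `[0%R, +oo[) (q^`().[expR (- r)] * expR (- r))%:E =
   (q.[1] - q.[0])%:E)%E.
Proof.
move=> q0.
have cexp : continuous (fun r : R => expR (- r)).
  move=> x; apply: (@continuous_comp _ _ _ (fun r : R => - r) expR).
    exact: continuousN.
  exact: continuous_expR.
have chorner (p : {poly R}) : continuous (fun r : R => p.[expR (- r)]).
  move=> x; apply: (@continuous_comp _ _ _ (fun r : R => expR (- r)) (horner p)).
    exact: cexp.
  exact: continuous_horner.
have dF (x : R) : is_derive x 1 (fun r : R => - q.[expR (- r)]) (q^`().[expR (- x)] * expR (- x)).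
  have dexp : is_derive x 1 (fun r : R => expR (- r)) (- expR (- x)).
    apply: is_derive_eq.
    by rewrite mulrN1.
  have dq : is_derive (expR (- x)) 1 (horner q) (q^`().[expR (- x)]).
    by rewrite derivE derive1E; apply: derivableP; exact: derivable_horner.
  apply: is_derive_eq.
  by rewrite mulrN opprK.
rewrite (@ge0_continuous_FTC2y _ _ (fun r => - q.[expR (- r)]) 0 (- q.[0])).
- by rewrite oppr0 expR0 -EFinB; congr EFin; rewrite opprK addrC.
- move=> x x0; rewrite mulr_ge0 ?expR_ge0// q0// expR_ge0/=.
  by rewrite -expR0 ler_expR oppr_le0.
- apply: continuous_subspaceT => x.
  by apply: cvgM; [exact: chorner|exact: cexp].
- apply: cvgN; apply: (cvg_comp (fun r : R => expR (- r)) (horner q)).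
    exact: cvgr_expR.
  exact: continuous_horner.
- by move=> x _; case: (dF x).
- apply: cvg_at_right_filter; apply: cvgN; exact: chorner.
- move=> x _; rewrite derive1E; by case: (dF x).
Qed.
End layer_cake.

Section power_law_expectation.
Context d (T : measurableType d) (R : realType) (P : probability T R).
Variables (U : {RV P >-> R}) (n : nat).
Hypothesis n0 : (0 < n)%N.
Hypothesis U01 : forall t, 0 <= U t <= 1.
Hypothesis U_lt_le : forall u : R, 0 < u < 1 ->
  (P (U @^-1` `]-oo, u[) <= (u ^+ n)%:E <= P (U @^-1` `]-oo, u]))%E.

Lemma power_law_eq0 : P (U @^-1` `]-oo, 0]) = 0%E.
Proof. by rewrite (power_law_le n0 U_lt_le) ?lexx ?ltr01// expr0n gtn_eqF. Qed.

(** Here [P (U < expR (- r)) = expR (- r) ^+ n], which makes the mean the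
    integral of [y ^+ n.-1] over [0, 1]. *)
Lemma expectation_Nln_power_law : (\int[P]_t (- ln (U t))%:E = (n%:R^-1)%:E)%E.
Proof.
rewrite expectation_Nln ?power_law_eq0//; last by move=> t; case/andP: (U01 t).
pose q : {poly R} := (n%:R^-1 : R) *: ('X^n : {poly R}).
have dq : q^`() = 'X^(n.-1).
  by rewrite derivZ derivXn -scalerMnr scalerMnl -mulr_natr mulVf ?scale1r// pnatr_eq0 -lt0n.
under eq_integral => r.
  rewrite inE/= in_itv/= andbT => r0.
  rewrite (power_law_lt U_lt_le (expRN_itv r0)).
  rewrite (_ : expR (- r) ^+ n = q^`().[expR (- r)] * expR (- r)); last first.
    by rewrite dq hornerXn -exprSr prednK.
  over.
rewrite integral_horner_expRN; last by move=> y /andP[y0 _]; rewrite dq hornerXn exprn_ge0.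
by rewrite !hornerE expr1n expr0n gtn_eqF// mulr0 subr0 mulr1.
Qed.

Let Uc (t : T) : R := 1 - U t.
Let measurable_Uc : measurable_fun setT Uc.
Proof. by apply: measurable_funB. Qed.
#[local] HB.instance Definition _ := isMeasurableFun.Build _ _ _ _ Uc measurable_Uc.

(** With [y = expR (- r)], the harmonic number appears through the geometric
    sum [P (1 - U < y) = 1 - (1 - y) ^+ n = y * \sum_(k < n) (1 - y) ^+ k], whose [k]-th term
    contributes the integral of [(1 - y) ^+ k] over [0, 1], that is
    [k.+1%:R^-1]. *)
Lemma expectation_Nln_onem_power_law :
  (\int[P]_t (- ln (1 - U t))%:E = (harmonic_number R n)%:E)%E.
Proof.
have le u : Uc @^-1` `]-oo, u[ = ~` (U @^-1` `]-oo, 1 - u]).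
  apply/seteqP; split => t /=; rewrite /Uc !in_itv/=.
    by move=> h; apply/negP; rewrite -ltNge; lra.
  by move=> /negP; rewrite -ltNge => h; lra.
have mU u : measurable (U @^-1` `]-oo, u]) by exact: measurable_funPTI.
have mU' u : measurable (U @^-1` `]-oo, u[) by exact: measurable_funPTI.
rewrite (@expectation_Nln _ _ _ _ Uc); first last.
- have -> : Uc @^-1` `]-oo, 0] = ~` (U @^-1` `]-oo, 1[).
    apply/seteqP; split => t /=; rewrite /Uc !in_itv/=.
      by move=> h; apply/negP; rewrite -leNgt; lra.
    by move=> /negP; rewrite -leNgt => h; lra.
  by rewrite probability_setC// (power_law_lt U_lt_le) ?ltr01 ?lexx// expr1n subee.
- by move=> t; rewrite /= /Uc gerBl; case/andP: (U01 t).
(* A primitive of the geometric sum, normalised to vanish at 1. *)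
pose q : {poly R} := - \sum_(k < n) (k.+1%:R^-1 : R) *: ((1 - 'X) ^+ k.+1 : {poly R}).
have dq : q^`() = \sum_(k < n) (1 - 'X) ^+ k.
  rewrite derivN (big_morph _ (@derivD R) (@deriv0 R)) -sumrN; apply: eq_bigr => k _.
  rewrite derivZ deriv_exp derivB derivX /= -polyC1 derivC sub0r mulN1r.
  by rewrite mulNrn scalerN opprK -scalerMnr scalerMnl -mulr_natr mulVf ?scale1r.
under eq_integral => r.
  rewrite inE/= in_itv/= andbT => r0.
  have /andP[e0 e1] := expRN_itv r0.
  rewrite le probability_setC// (power_law_le n0 U_lt_le); last by apply/andP; split; lra.
  rewrite -EFinB.
  rewrite (_ : 1 - _ = q^`().[expR (- r)] * expR (- r)); last first.
    set y := expR _; rewrite dq horner_sum.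
    under eq_bigr do rewrite !hornerE.
    have := subrX1 (1 - y) n.
    rewrite (_ : 1 - y - 1 = - y); last by ring.
    by rewrite mulNr [y * _]mulrC => e; rewrite -opprB e opprK.
  over.
rewrite integral_horner_expRN; last first.
  move=> y /andP[y0 y1]; rewrite dq horner_sum sumr_ge0// => k _.
  by rewrite !hornerE exprn_ge0// subr_ge0.
congr EFin; rewrite /q !hornerE !horner_sum.
rewrite [X in - X - _]big1 ?oppr0 ?sub0r ?opprK; last first.
  by move=> k _; rewrite !hornerE subrr expr0n mulr0.
rewrite /harmonic_number big_add1/= big_mkord.
by apply: eq_bigr => k _; rewrite !hornerE subr0 expr1n mulr1.
Qed.
End power_law_expectation.

(** * Max-score of the normed maximum *)

Lemma measurable_dist_fun d (T : measurableType d) (R : realType)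
    (P : probability T R) (X : {RV P >-> R}) :
  measurable_fun setT (dist_fun X).
Proof. exact: measurableT_comp (cdf_measurable X). Qed.

Lemma dist_fun_itv01 d (T : measurableType d) (R : realType)
    (P : probability T R) (X : {RV P >-> R}) x : 0 <= dist_fun X x <= 1.
Proof.
by rewrite fine_ge0//= -lee_fin fineK ?cdf_le1// fin_num_measure.
Qed.

Lemma le_dist_fun d (T : measurableType d) (R : realType)
    (P : probability T R) (X : {RV P >-> R}) :
  {homo dist_fun X : x y / x <= y}.
Proof.
by move=> x y xy; rewrite fine_le ?fin_num_measure// cdf_nondecreasing.
Qed.

Lemma dist_fun_normed d (T : measurableType d) (R : realType)
    (P : probability T R) (a b : R) (Z : {RV P >-> R}) (z : R) : 0 < a ->
  dist_fun (normed a b Z : {RV P >-> R}) z = dist_fun Z (a * z + b).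
Proof.
move=> a0; rewrite /dist_fun /cdf /distribution /pushforward.
congr (fine (P _)); apply/seteqP; split => t /=;
  by rewrite /normed !in_itv/= ler_pdivrMr// lerBlDr mulrC.
Qed.

Section score_of_maximum.
Context d0 (T0 : measurableType d0) d (T : measurableType d) (R : realType).
Context (P0 : probability T0 R) (P : probability T R).
Variables (X : {RV P0 >-> R}) (M : {RV P >-> R}) (n : nat).
Hypotheses (hX : abs_continuous X) (n0 : (0 < n)%N).
Hypothesis FM : forall x, dist_fun M x = dist_fun X x ^+ n.

(** If [dist_fun X x = u] then, by monotonicity, [M <= x] holds whenever
    [dist_fun X M < u] and implies [dist_fun X M <= u].  Any such [x] serves,
    even if the distribution function is flat at the level [u]. *)
Lemma dist_fun_max_sandwich (u : R) : 0 < u < 1 ->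
  (P ((dist_fun X \o M) @^-1` `]-oo, u[) <= (u ^+ n)%:E <=
   P ((dist_fun X \o M) @^-1` `]-oo, u]))%E.
Proof.
move=> u01; have [x Fx] := dist_fun_intermediate hX u01.
have mFM : measurable_fun setT (dist_fun X \o M).
  exact: measurableT_comp (measurable_dist_fun X) _.
have mpre (A : set R) : measurable A -> measurable ((dist_fun X \o M) @^-1` A).
  by move=> mA; rewrite -[X in measurable X]setTI; exact: mFM.
have <- : P (M @^-1` `]-oo, x]) = (u ^+ n)%:E.
  rewrite -Fx -FM /dist_fun /cdf fineK// fin_num_measure//; exact: measurable_funPTI.
have mM : measurable (M @^-1` `]-oo, x]) by exact: measurable_funPTI.
apply/andP; split; apply: le_measure; rewrite ?inE//; try exact: mpre.
  move=> t /=; rewrite !in_itv/= -Fx => h.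
  by rewrite leNgt; apply/negP => /ltW/(le_dist_fun X); rewrite leNgt h.
by move=> t /=; rewrite !in_itv/= -Fx; exact: le_dist_fun.
Qed.

Lemma ln_hazardE x : 0 < density X x -> dist_fun X x < 1 ->
  ln (hazard X x) = ln (density X x) - ln (1 - dist_fun X x).
Proof. by move=> f0 F1; rewrite /hazard ln_div ?posrE ?subr_gt0. Qed.

(** The normed maximum has distribution function [z |-> F (a z + b) ^+ n], so
    at [M = a z + b] its max-score is [ln (n a f(M) / F(M))]; inserting
    [1 - F(M)] produces the hazard. *)
Lemma max_score_normedE (a b : R) (t : T) : 0 < a ->
  derivable (dist_fun X) (M t) 1 -> 0 < density X (M t) ->
  0 < dist_fun X (M t) < 1 ->
  max_score (normed a b M : {RV P >-> R}) (normed a b M t) =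
  ln (hazard X (M t)) +
  (ln n%:R + ln a - ln (dist_fun X (M t)) + ln (1 - dist_fun X (M t))).
Proof.
move=> a0 dF f0 /andP[F0 F1].
set N : {RV P >-> R} := normed a b M.
have FN : dist_fun N = (fun z => dist_fun X (a * z + b) ^+ n).
  by apply/funext => z; rewrite dist_fun_normed// FM.
have aNb : a * normed a b M t + b = M t.
  by rewrite /normed mulrCA mulfV ?gt_eqF// mulr1 subrK.
rewrite ln_hazardE//.
set F := dist_fun X (M t); set g := density X (M t).
have dens : density N (normed a b M t) = n%:R * F ^+ n.-1 * (g * a).
  set z := normed a b M t.
  have dX : is_derive (a * z + b) 1 (dist_fun X) g.
    by rewrite aNb /g /density derive1E; exact: derivableP.
  have daff : is_derive z 1 (fun y : R => a * y + b) a.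
    by apply: is_derive_eq; rewrite /GRing.scale/= mulr1 addr0.
  have dcomp := @is_derive1_comp R (dist_fun X) (fun y : R => a * y + b) z g a dX daff.
  have [_ dN] := is_deriveX n dcomp.
  rewrite /density derive1E FN.
  rewrite (_ : (fun y => _) = (dist_fun X \o (fun y : R => a * y + b)) ^+ n).
    by rewrite dN /GRing.scale/= aNb -mulrA.
  by apply/funext => y; rewrite fctE.
rewrite /max_score dens FN aNb -/F.
rewrite (_ : _ / _ = n%:R * a * g / F); last first.
  rewrite -[in X in _ / X = _](prednK n0) exprS.
  field.
  by rewrite ?expf_neq0 ?gt_eqF.
have nR : 0 < n%:R :> R by rewrite ltr0n.
rewrite !ln_div ?posrE ?mulr_gt0//.
rewrite lnM ?posrE ?mulr_gt0// lnM ?posrE//.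
lra.
Qed.

End score_of_maximum.

Section expectation_of_max_score.
Context d0 (T0 : measurableType d0) d (T : measurableType d) (R : realType).
Context (P0 : probability T0 R) (P : probability T R).
Variables (X : {RV P0 >-> R}) (M : {RV P >-> R}) (n : nat).
Hypotheses (hX : abs_continuous X) (n0 : (0 < n)%N).
Hypothesis FM : forall x, dist_fun M x = dist_fun X x ^+ n.
Hypothesis M_null : forall B : set R, measurable B ->
  distribution P0 X B = 0%E -> P (M @^-1` B) = 0%E.

Let U : T -> R := dist_fun X \o M.
Let mU : measurable_fun setT U.
Proof. exact: measurableT_comp (measurable_dist_fun X) _. Qed.
#[local] HB.instance Definition _ := isMeasurableFun.Build _ _ _ _ U mU.
Let U01 t : 0 <= U t <= 1.
Proof. exact: dist_fun_itv01. Qed.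
Let sandwich := dist_fun_max_sandwich hX FM.

Let integrable_Nln (V : T -> R) (c : R) : measurable_fun setT V ->
  (forall t, V t <= 1) -> (\int[P]_t (- ln (V t))%:E = c%:E)%E ->
  P.-integrable setT (fun t => (- ln (V t))%:E).
Proof.
move=> mV V1 Vc; apply/integrableP; split.
  apply/measurable_EFinP; apply: measurableT_comp => //.
  exact: measurableT_comp.
under eq_integral => t _.
  rewrite gee0_abs ?lee_fin ?oppr_ge0 ?ln_le0//.
  over.
by rewrite Vc ltry.
Qed.

(** [ln (1 - U) - ln U] is a difference of two nonnegative variables with
    finite means, hence integrable; this is what allows its mean to be split
    off from that of the log-hazard, which may be infinite or undefined. *)
Lemma expectation_log_odds (c : R) :
  P.-integrable setT (fun t => (c - ln (U t) + ln (1 - U t))%:E) /\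
  (\int[P]_t (c - ln (U t) + ln (1 - U t))%:E =
    (c + n%:R^-1 - harmonic_number R n)%:E)%E.
Proof.
have U_le1 t : U t <= 1 by case/andP: (U01 t).
have onemU_le1 t : 1 - U t <= 1 by rewrite gerBl; case/andP: (U01 t).
have e1 := expectation_Nln_power_law n0 U01 sandwich.
have e2 := expectation_Nln_onem_power_law n0 U01 sandwich.
have i1 := integrable_Nln mU U_le1 e1.
have i2 : P.-integrable setT (fun t => (- ln (1 - U t))%:E).
  by apply: integrable_Nln e2 => //; apply: measurable_funB.
have ic : P.-integrable setT (fun=> c%:E) by exact: finite_measure_integrable_cst.
have E : (fun t => (c - ln (U t) + ln (1 - U t))%:E) =
    ((fun=> c%:E) \+ (fun t => (- ln (U t))%:E) \- (fun t => (- ln (1 - U t))%:E))%E.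
  by apply/funext => t /=; rewrite -!EFinD opprK.
rewrite E; split.
  by apply: integrableB => //; apply: integrableD.
rewrite integralB//; last by apply: integrableD.
rewrite integralD// e1 e2 integral_cst//.
rewrite [X in (_ * X)%E](_ : _ = 1%E) ?mule1//.
exact: probability_setT.
Qed.

(** Off the null event [S] the pointwise identity holds and the log-hazard
    coincides with the measurable function [phi]. *)
Lemma expectation_max_score_normed (a b : R) : 0 < a ->
  ('E_P[fun t => max_score (normed a b M : {RV P >-> R}) (normed a b M t)] =
   'E_P[fun t => ln (hazard X (M t))] +
   (ln n%:R + ln a + n%:R^-1 - harmonic_number R n)%:E)%E.
Proof.
move=> a0.
have [g [B [mg mB B0 hB]]] := dist_fun_density_ae hX.
have mpre (A : set R) : measurable A -> measurable (U @^-1` A).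
  by move=> mA; exact: measurable_funPTI.
pose S := M @^-1` B `|` (U @^-1` `]-oo, 0] `|` ~` (U @^-1` `]-oo, 1[)).
have mMB : measurable (M @^-1` B) by exact: measurable_funPTI.
have mS : measurable S.
  apply: measurableU => //; apply: measurableU; first exact: mpre.
  by apply: measurableC; exact: mpre.
have S0 : P S = 0%E.
  apply/(negligibleP _ mS); apply: negligibleU.
    by apply/negligibleP => //; exact: M_null.
  apply: negligibleU.
    apply/negligibleP; first exact: mpre.
    exact: (@power_law_eq0 _ _ _ P U n n0 sandwich).
  apply/negligibleP; first by apply: measurableC; exact: mpre.
  rewrite [LHS](probability_setC _ (mpre _ _))//.
  by rewrite (@power_law_lt _ _ _ P U n sandwich) ?ltr01 ?lexx// expr1n subee.
have good t : ~ S t -> [/\ derivable (dist_fun X) (M t) 1,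
    density X (M t) = g (M t), 0 < g (M t) & 0 < U t < 1].
  move=> /not_orP[/hB[? ? ?] /not_orP[/= + /contrapT/=]].
  rewrite !in_itv/= => /negP; rewrite -ltNge => U0 U1.
  by split => //; rewrite U0.
(* A measurable stand-in for the log-hazard, with the Radon-Nikodym density in
   place of the derivative. *)
pose phi t := ln (g (M t)) - ln (1 - U t).
have mphi : measurable_fun setT phi.
  apply: measurable_funB; apply: measurableT_comp => //; last exact: measurable_funB.
  exact: measurableT_comp.
have phiE t : ~ S t -> ln (hazard X (M t)) = phi t.
  by move=> /good[_ e g0 /andP[_ U1]]; rewrite ln_hazardE ?e.
rewrite unlock.
have -> : (\int[P]_t (ln (hazard X (M t)))%:E = \int[P]_t (phi t)%:E)%E.
  by apply: (ae_eq_integralT mS S0) => t /phiE ->.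
have [ipsi epsi] := expectation_log_odds (ln n%:R + ln a).
rewrite -epsi -(integralD_integrabler mphi ipsi).
apply: (ae_eq_integralT mS S0) => t St; have [dF e g0 U01t] := good t St.
by rewrite (max_score_normedE n0 FM) ?e// phiE.
Qed.

End expectation_of_max_score.

Theorem lemma3p2 (R : realType)
    (d0 : measure_display) (T0 : measurableType d0) (P0 : probability T0 R)
    (d : measure_display) (T : measurableType d) (P : probability T R)
    (X : {RV P0 >-> R}) (Xs : nat -> {RV P >-> R}) (a b : nat -> R)
    (hX : abs_continuous X) (hXs : iid_copies X Xs)
    (ha : forall n : nat, (0 < n)%N -> 0 < a n)
    (n : nat) (hn : (0 < n)%N) :
  let M : {RV P >-> R} := sample_max Xs n in
  let N : {RV P >-> R} := normed (a n) (b n) M in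
  'E_P[fun t => max_score N (N t)]%E =
  (((ln (a n))%:E + 'E_P[fun t => ln (hazard X (M t))])
   + (ln n%:R - harmonic_number R n)%:E + (n%:R^-1)%:E)%E.
Proof.
move=> M N.
have FM := dist_fun_sample_max hXs hn.
have M_null := @sample_max_null _ _ _ _ _ _ _ _ _ n hXs.
rewrite (expectation_max_score_normed hX hn FM M_null (b n) (ha n hn)).
rewrite [in RHS](addeC (ln (a n))%:E) -!addeA -!EFinD.
by congr (_ + _%:E)%E; ring.
Qed.
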